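(* Let $(\theta(t),\omega(t))$, $t\ge 0$, be a solution to the inertial Kuramoto system with frustration $$m\ddot\theta_i(t)+\dot\theta_i(t)=\Omega_i+\frac{K}{N}\sum_{j=1}^N\psi_{ij}\sin(\theta_j(t)-\theta_i(t)+\alpha),\qquad i=1,\dots,N,$$ with $\omega_i=\dot\theta_i$ and initial data $(\theta_i(0),\omega_i(0))=(\theta_{i0},\omega_{i0})$, on a symmetric and connected network. Suppose there are positive constants $\beta,\gamma,D^\infty,\delta,c$ such that, with $\eta=1-\frac{2}{c}$ and $S_c=\sum_{n=0}^{N-1}c^n$, the following hold. (1) $\beta\in(0,\pi)$ and $2mD(\Omega)+4mK\psi_u\sin\alpha+(1+4mK\psi_u\cos\alpha)D_\theta(0)+3mD_\omega(0)<\beta$. (2) $\beta<\gamma<\pi$, $\ 0<D^\infty<\min\{\frac{\pi}{2},\beta\}$, $\ \alpha<\delta<\frac{\pi}{2}-D^\infty$, $\ c>\max\left\{\frac{2}{\cos(D^\infty+\delta)},\frac{2}{1-\frac{\beta}{\gamma}}\right\}$. (3) $$mK<\min\left\{\frac{\eta^2\psi_l\sin\gamma}{16N\psi_u^2S_c\gamma},\ \frac{NS_c}{2\psi_l}\right\},\qquad K>\frac{4(D(\Omega)+2K\psi_u\sin\alpha)NS_c\gamma}{D^\infty\eta\psi_l\cos\alpha\sin\gamma},$$ $$K>\frac{64(D(\Omega)+2K\psi_u\sin\alpha)(D^\infty\cos\alpha+\sin\alpha)N^3\psi_u^2S_c^3\gamma^2}{\eta^3\psi_l^3\cos\alpha\sin^2\gamma}.$$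 Then there exist a time $t_*\ge 0$ and positive constants $C$ and $\Lambda$, depending on the initial data and the system parameters, such that $$D_\omega(t)\le Ce^{-\Lambda(t-t_* )},\qquad t\ge t_*.$$
   Context: $N\ge 2$ is an integer, $m>0$ (inertia), $K>0$ (coupling strength), $0<\alpha<\frac{\pi}{2}$ (frustration), $\Omega_1,\dots,\Omega_N\in\mathbb{R}$ (natural frequencies). $\Psi=(\psi_{ij})$ is an $N\times N$ matrix with $\psi_{ij}\ge 0$, and $E=\{(j,i):\psi_{ij}>0\}\subset\{1,\dots,N\}^2$ is the edge set. The network is symmetric ($\psi_{ij}=\psi_{ji}$) and connected (any two vertices are joined by a path of edges in $E$). The phases satisfy $\theta_i(t)\in\mathbb{R}$, and $\omega_i=\dot\theta_i$. Notation: $D_\theta(t)=\max_i\theta_i(t)-\min_i\theta_i(t)$, $D_\omega(t)=\max_i\omega_i(t)-\min_i\omega_i(t)$, $D(\Omega)=\max_i\Omega_i-\min_i\Omega_i$, $\psi_u=\max_{(i,j)\in E}\psi_{ji}$, $\psi_l=\min_{(i,j)\in E}\psi_{ji}$. *)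

(* Defs.v *)
From mathcomp Require Import all_boot all_order all_algebra.
From mathcomp Require Import all_classical all_reals all_analysis.

Set Implicit Arguments.
Unset Strict Implicit.
Unset Printing Implicit Defensive.

Import Order.TTheory GRing.Theory Num.Theory.
Import numFieldNormedType.Exports.

Local Open Scope ring_scope.

(* The default value [head 0 s] makes these the true maximum and minimum of
   every nonempty list, including lists of elements all of the same sign. *)
Definition maxs (R : realType) (s : seq R) : R :=
  \big[Num.max/head 0 s]_(x <- s) x.
Definition mins (R : realType) (s : seq R) : R :=
  \big[Num.min/head 0 s]_(x <- s) x.

Definition diam (R : realType) (N : nat) (x : 'I_N -> R) : R :=
  maxs [seq x i | i : 'I_N] - mins [seq x i | i : 'I_N].

Section Network.
Variables (R : realType) (N : nat) (psi : 'M[R]_N).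

(* The pair (j, i) is an edge when psi i j > 0. *)
Definition edges : pred ('I_N * 'I_N) := [pred e | 0 < psi e.2 e.1].

Definition symmetric_network : Prop := forall i j, psi i j = psi j i.

Definition connected_network : Prop :=
  forall i j, connect [rel k l | (k, l) \in edges] i j.

Definition psi_u : R := maxs [seq psi e.2 e.1 | e in edges].
Definition psi_l : R := mins [seq psi e.2 e.1 | e in edges].

End Network.

(* Derivative of f at t relative to the half-line [0, +oo): the two-sided
   derivative when t > 0, and the right derivative when t = 0. *)
Definition has_deriv_nonneg (R : realType) (f : R -> R) (t l : R) : Prop :=
  ((f s - f t) / (s - t) @[s --> within [set s : R | 0 <= s] t^'] --> l)%classic.

Definition kuramoto_solution (R : realType) (N : nat) (m K alpha : R)
    (Omega : 'I_N -> R) (psi : 'M[R]_N) (theta omega : R -> 'I_N -> R) : Prop :=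
  forall (t : R) (i : 'I_N), 0 <= t ->
    has_deriv_nonneg (fun s => theta s i) t (omega t i) /\
    exists2 a : R, has_deriv_nonneg (fun s => omega s i) t a &
      m * a + omega t i =
        Omega i + K / N%:R *
          \sum_(j < N) psi i j * sin (theta t j - theta t i + alpha).

Definition eta (R : realType) (c : R) : R := 1 - 2 / c.

Definition geom_sum (R : realType) (N : nat) (c : R) : R :=
  \sum_(0 <= n < N) c ^+ n.

(* Main.v *)
(* The shifted phase z = theta + m * omega solves the first-order equation
   z' = force theta, and omega relaxes to force theta on the time scale m.
   Weight the agents, sorted by decreasing z, by the geometric weights
   c^(N-1), ..., c, 1, and let Q be this weighted mean minus the one for the
   opposite order, so that eta * diam z <= Q <= diam z.  Sorting maximizes the
   weighted mean over all permutations, so Q + kap * m * diam omega is the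
   maximum of a finite family of functions linear in z and omega, and it suffices
   to bound the derivative of a member at a time when it realizes the maximum.
   There, symmetry of psi pairs up the couplings so that the agent with the larger
   weight wins, and connectivity bounds the resulting dissipation from below by
   diam z; small inertia absorbs the terms in diam omega.  A barrier argument
   then drives diam theta below Dinf.  From that time on, force theta and its
   derivative satisfy the same system with theta replaced by omega, couplings
   cos (theta_l - theta_k + alpha) between cos (Dinf + delta) > 2 / c and 1, and
   no forcing; the same estimate gives exponential decay of diam omega. *)
Require Import Defs.
From mathcomp Require Import all_boot all_order all_algebra.
From mathcomp Require Import all_fingroup.
From mathcomp Require Import all_classical all_reals all_analysis.
From mathcomp Require Import ring lra.

Set Implicit Arguments.
Unset Strict Implicit.
Unset Printing Implicit Defensive.

Import Order.TTheory GRing.Theory Num.Theory.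
Import numFieldNormedType.Exports.

Local Open Scope ring_scope.

(** * Diameter and connectivity *)

Section Extrema.
Variable R : realType.
Implicit Type s : seq R.

Lemma maxs_mem s : s != [::] -> maxs s \in s.
Proof.
move=> s0; rewrite /maxs big_seq; apply: (big_ind (fun y => y \in s)) => //.
- by case: s s0 => // a s _; rewrite mem_head.
- by move=> x y xs ys; rewrite /Num.max; case: ifP.
Qed.

Lemma mins_mem s : s != [::] -> mins s \in s.
Proof.
move=> s0; rewrite /mins big_seq; apply: (big_ind (fun y => y \in s)) => //.
- by case: s s0 => // a s _; rewrite mem_head.
- by move=> x y xs ys; rewrite /Num.min; case: ifP.
Qed.

Lemma maxs_ge s x : x \in s -> x <= maxs s.
Proof. by move=> xs; rewrite /maxs; apply: le_bigmax_seq. Qed.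

Lemma mins_le s x : x \in s -> mins s <= x.
Proof. by move=> xs; rewrite /mins; apply: ge_bigmin_seq. Qed.

Variable N : nat.
Implicit Types x y : 'I_N -> R.

Lemma diam_ge x i j : x i - x j <= diam x.
Proof. by apply: lerB; [apply: maxs_ge|apply: mins_le]; rewrite fintype.image_f. Qed.

Lemma diam_attained x : (0 < N)%N ->
  exists p q, [/\ diam x = x p - x q, forall i, x i <= x p & forall i, x q <= x i].
Proof.
move=> N0; set s := [seq x i | i : 'I_N].
have s0 : s != [::] by rewrite -size_eq0 size_image card_ord -lt0n.
have /fintype.imageP[p _ xp] := maxs_mem s0; have /fintype.imageP[q _ xq] := mins_mem s0.
exists p, q; split; first by rewrite /diam -/s xp xq.
- by move=> i; rewrite -xp maxs_ge // fintype.image_f.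
- by move=> i; rewrite -xq mins_le // fintype.image_f.
Qed.

Lemma diam_ge0 x : (0 < N)%N -> 0 <= diam x.
Proof. by move=> N0; rewrite -(subrr (x (Ordinal N0))) diam_ge. Qed.

Lemma diam_le x (d : R) : (0 < N)%N -> (forall i j, x i - x j <= d) -> diam x <= d.
Proof. by move=> /(diam_attained x)[p [q [-> _ _]]]. Qed.

Lemma diam_norm x i j : `|x i - x j| <= diam x.
Proof. by rewrite ler_norml lerNl opprB !diam_ge. Qed.

Lemma diam_opp x : (0 < N)%N -> diam (fun i => - x i) = diam x.
Proof.
move=> N0; apply/eqP; rewrite eq_le; apply/andP; split; apply: diam_le => // i j.
  by rewrite opprK addrC diam_ge.
by have := diam_ge (fun i => - x i) j i; rewrite /= opprK addrC.
Qed.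

End Extrema.

Section Network.
Variables (R : realType) (N : nat) (psi : 'M[R]_N).
Hypothesis psi_ge0 : forall i j, 0 <= psi i j.
Hypothesis N2 : (2 <= N)%N.
Hypothesis psi_conn : connected_network psi.

Let N0 : (0 < N)%N. Proof. exact: leq_trans N2. Qed.

(** As [N] is at least 2, a path joining the first two vertices has a first step, which is an edge.
    Hence [psi_l] and [psi_u] are attained at genuine edges. *)
Lemma edges_nonempty : [seq psi e.2 e.1 | e in edges psi] != [::].
Proof.
have /connectP[[|k p] /=] := psi_conn (Ordinal N0) (Ordinal N2).
  by move=> _ /(congr1 val).
move=> /andP[e _] _.
have: psi k (Ordinal N0) \in [seq psi e.2 e.1 | e in edges psi].
  by apply/fintype.imageP; exists (Ordinal N0, k).
by case: [seq psi e.2 e.1 | e in edges psi].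
Qed.

Lemma psi_l_gt0 : 0 < psi_l psi.
Proof. by rewrite /psi_l; have /fintype.imageP[e + ->] := mins_mem edges_nonempty. Qed.

Lemma psi_u_gt0 : 0 < psi_u psi.
Proof. by rewrite /psi_u; have /fintype.imageP[e + ->] := maxs_mem edges_nonempty. Qed.

Lemma psi_l_le i j : 0 < psi i j -> psi_l psi <= psi i j.
Proof. by move=> h; apply: mins_le; apply/fintype.imageP; exists (j, i). Qed.

Lemma psi_u_ge i j : psi i j <= psi_u psi.
Proof.
have [h|h] := ltP 0 (psi i j); last exact: le_trans h (ltW psi_u_gt0).
by apply: maxs_ge; apply/fintype.imageP; exists (j, i).
Qed.

Lemma psi_lu : psi_l psi <= psi_u psi.
Proof.
rewrite {1}/psi_l; have /fintype.imageP[e _ ->] := mins_mem edges_nonempty.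
exact: psi_u_ge.
Qed.

(* The steps of a simple path from the minimum to the maximum of x are distinct
   ordered pairs, and their positive parts telescope to at least diam x. *)
Lemma diam_le_sum_edges (x : 'I_N -> R) :
  psi_l psi * diam x <= \sum_k \sum_l psi k l * Num.max 0 (x k - x l).
Proof.
have [p [q [-> _ _]]] := diam_attained x N0.
have /connectP[r0 r0p ep] := psi_conn q p.
move: ep; case/shortenP: r0p => r rpath runiq _ ep.
rewrite pair_big /=.
pose F (e : 'I_N * 'I_N) := psi e.1 e.2 * Num.max 0 (x e.1 - x e.2).
have F0 e : 0 <= F e by rewrite mulr_ge0 // le_max lexx.
pose s := zip r (q :: r).
have su : uniq s by apply: zip_uniql; case/andP: runiq.
apply: (@le_trans _ _ (\sum_(e <- s) F e)); last first.
  rewrite big_uniq //= [leRHS](bigID (fun e => e \in s)) /= lerDl.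
  by apply: sumr_ge0 => e _; exact: F0.
rewrite {su}/s ep; elim: r {r0 runiq ep} q rpath => [|a r IH] q /=.
  by rewrite big_nil subrr mulr0.
move=> /andP[e /IH IHr]; rewrite big_cons.
have -> : x (last a r) - x q = (x a - x q) + (x (last a r) - x a) by ring.
rewrite mulrDr lerD // /F /=.
apply: (@le_trans _ _ (psi_l psi * Num.max 0 (x a - x q))).
  apply: ler_wpM2l; first exact/ltW/psi_l_gt0.
  by rewrite le_max lexx orbT.
by apply: ler_wpM2r; [rewrite le_max lexx|apply: psi_l_le].
Qed.

End Network.

(** * Geometrically weighted means over permutations *)

Section OrderedSum.
Variables (R : realType) (N : nat) (c : R).
Hypothesis c2 : 2 < c.
Hypothesis N2 : (2 <= N)%N.

(** Rank 0 carries the largest weight: the exponents run from [N - 1] down to 0, and division by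
    [geom_sum] makes the total 1. *)
Definition weight (r : 'I_N) : R := c ^+ (N - r.+1) / geom_sum N c.

Let N0 : (0 < N)%N. Proof. exact: leq_trans N2. Qed.
Let c0 : 0 < c. Proof. exact: lt_trans c2. Qed.
Let c1 : 1 <= c. Proof. move: c2; lra. Qed.

Lemma geom_sum_ge1 : 1 <= geom_sum N c.
Proof.
rewrite /geom_sum big_ltn // expr0 lerDl.
by apply: sumr_ge0 => n _; rewrite exprn_ge0 // ltW.
Qed.

Let S0 : 0 < geom_sum N c. Proof. exact: lt_le_trans geom_sum_ge1. Qed.

Lemma weight_ge r : (geom_sum N c)^-1 <= weight r.
Proof. by apply: ler_peMl; [rewrite invr_ge0 ltW|apply: exprn_ege1]. Qed.

Lemma weight_gt0 r : 0 < weight r.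
Proof. by apply: lt_le_trans (weight_ge r); rewrite invr_gt0. Qed.

Lemma weight_ratio (r s : 'I_N) : (r < s)%N -> c * weight s <= weight r.
Proof.
move=> rs; rewrite /weight mulrA -exprS; apply: ler_wpM2r; first by rewrite invr_ge0 ltW.
by apply: ler_weXn2l => //; rewrite -subSn ?ltn_ord // subSS leq_sub2l.
Qed.

Lemma weight_sum (s : {perm 'I_N}) : \sum_k weight (s k) = 1.
Proof.
transitivity (\sum_k weight k); first by rewrite [RHS](reindex_inj (@perm_inj _ s)).
rewrite -mulr_suml.
rewrite (_ : \sum_(i < N) _ = geom_sum N c) ?divff ?gt_eqF //.
by rewrite /geom_sum big_mkord [RHS](reindex_inj rev_ord_inj).
Qed.

(** With [S] the geometric sum, [S = 1 + c (S - c^(N-1))], so the ranks after the first weigh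
    together at most [S / c] before normalization. *)
Lemma weight_top : 1 - weight (Ordinal N0) <= c^-1.
Proof.
have SE : geom_sum N c = 1 + c * (geom_sum N c - c ^+ N.-1).
  rewrite /geom_sum -(prednK N0) /=.
  rewrite [in RHS]big_nat_recr //= addrK big_nat_recl // expr0 mulr_sumr.
  by congr (_ + _); apply: eq_bigr => n _; rewrite exprS.
rewrite /weight /= subn1 -(ler_pM2l c0) divff ?gt_eqF // -(ler_pM2r S0) mul1r.
rewrite -mulrA mulrBl mul1r divfK ?gt_eqF //.
by rewrite {2}SE lerDr.
Qed.

(** The permutation sends each agent to its rank. *)
Definition ordered_sum (s : {perm 'I_N}) (x : 'I_N -> R) : R :=
  \sum_k weight (s k) * x k.

Lemma ordered_sumN s x : ordered_sum s (fun k => - x k) = - ordered_sum s x.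
Proof. by rewrite /ordered_sum -sumrN; apply: eq_bigr => k _; rewrite mulrN. Qed.

Lemma ordered_sum_le s x (d : R) : (forall i, x i <= d) -> ordered_sum s x <= d.
Proof.
move=> xd; rewrite -[d]mul1r -(weight_sum s) mulr_suml; apply: ler_sum => k _.
by apply: ler_wpM2l => //; rewrite ltW ?weight_gt0.
Qed.

Lemma ordered_sum_diff s t x : ordered_sum s x - ordered_sum t x <= diam x.
Proof.
have [p [q [-> xp xq]]] := diam_attained x N0.
apply: lerB; first exact: ordered_sum_le.
by rewrite -lerN2 -ordered_sumN ordered_sum_le // => i; rewrite lerN2.
Qed.

(** A transposition puts an agent of largest value in rank 0. The others carry total weight at most
    [1 / c] and lie at most [diam x] below it. *)
Lemma ordered_sum_top x : exists s, forall i, x i - diam x / c <= ordered_sum s x.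
Proof.
have [p [q [dE xp xq]]] := diam_attained x N0.
have d0 := diam_ge0 x N0.
exists (tperm p (Ordinal N0)) => i; set s := tperm _ _.
have w := weight_sum s; have wtop := weight_top.
rewrite (bigD1 p) //= tpermL in w.
rewrite /ordered_sum (bigD1 p) //= tpermL.
have h : (1 - weight (Ordinal N0)) * (x p - diam x) <= \sum_(k | k != p) weight (s k) * x k.
  have -> : 1 - weight (Ordinal N0) = \sum_(k | k != p) weight (s k) by lra.
  rewrite mulr_suml; apply: ler_sum => k _; apply: ler_wpM2l; first by rewrite ltW ?weight_gt0.
  by have := diam_ge x p k; lra.
have h2 : (1 - weight (Ordinal N0)) * diam x <= c^-1 * diam x by rewrite ler_wpM2r.
by have := xp i; lra.
Qed.

(** Rearrangement: if the smaller of two values had the better rank, exchanging the two ranks would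
    strictly increase the sum. *)
Lemma ordered_sum_max s x : (forall t, ordered_sum t x <= ordered_sum s x) ->
  forall k l, x l < x k -> (s k < s l)%N.
Proof.
move=> smax k l xlk; rewrite ltnNge leq_eqVlt; apply/negP => /orP[/eqP/val_inj/perm_inj e|h].
  by rewrite e ltxx in xlk.
have kl : k != l by apply: contraTneq xlk => ->; rewrite ltxx.
have := smax (tperm k l * s)%g; apply/negP; rewrite -ltNge -subr_gt0.
rewrite /ordered_sum -sumrB (bigD1 k) //= (bigD1 l) 1?eq_sym //= big1 ?addr0.
  rewrite !permM tpermL tpermR.
  have -> : weight (s l) * x k - weight (s k) * x k +
    (weight (s k) * x l - weight (s l) * x l) = (weight (s l) - weight (s k)) * (x k - x l) by ring.
  apply: mulr_gt0; rewrite subr_gt0 //; apply: lt_le_trans (weight_ratio h).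
  by rewrite ltr_pMl ?weight_gt0 // (lt_trans _ c2) // ltr1n.
by move=> i /andP[ik il]; rewrite permM tpermD 1?eq_sym // subrr.
Qed.

End OrderedSum.

(** * Dissipation of the energy *)

Section Dissipation.
Variables (R : realType) (N : nat) (c : R) (psi : 'M[R]_N).
Hypothesis c2 : 2 < c.
Hypothesis N2 : (2 <= N)%N.
Hypothesis psi_ge0 : forall i j, 0 <= psi i j.
Hypothesis psi_sym : symmetric_network psi.
Hypothesis psi_conn : connected_network psi.

Let N0 : (0 < N)%N. Proof. exact: leq_trans N2. Qed.
Let S0 : 0 < geom_sum N c. Proof. exact: lt_le_trans (geom_sum_ge1 c2 N2). Qed.

(** [s k l] pulls the upper agent [k] down. Its weight is at least [c] times that of [l], so the
    second inequality is the contraction left after the reverse term [s l k]. *)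
Definition dissipative (lam : R) (z : 'I_N -> R) (s : 'I_N -> 'I_N -> R) :=
  forall k l, z l <= z k ->
    s k l <= 0 /\ c * s k l + s l k <= - (lam * (z k - z l)).

(* Symmetrizing over (k, l): the agent with larger z has weight at least c times
   that of the other, so c * s k l + s l k controls the pair. *)
Lemma ordered_sum_coupling (lam : R) z s (p : {perm 'I_N}) : 0 <= lam ->
  (forall t, ordered_sum c t z <= ordered_sum c p z) ->
  dissipative lam z s ->
  ordered_sum c p (fun k => \sum_l psi k l * s k l)
    <= - (psi_l psi * lam / geom_sum N c * diam z).
Proof.
move=> lam0 pmax sP; set S := geom_sum N c; set w := fun k => weight c (p k).
have w0 k : 0 < w k by apply: weight_gt0.
have pair_le k l : z l <= z k ->
    w k * s k l + w l * s l k <= - (lam / S * (z k - z l)).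
  rewrite le_eqVlt => /orP[/eqP e|zlk].
    have [|s1 _] := sP k l; first by rewrite e.
    have [|s2 _] := sP l k; first by rewrite e.
    rewrite e subrr mulr0 oppr0 -(addr0 0).
    by apply: lerD; apply: mulr_ge0_le0 => //; apply: ltW.
  have [s1 s2] := sP k l (ltW zlk).
  have wkl : c * w l <= w k.
    by apply: (weight_ratio c2 N2); apply: (ordered_sum_max c2 N2 pmax).
  have Sw : S^-1 <= w l := weight_ge c2 N2 _.
  have h1 : (w k - c * w l) * s k l <= 0 by rewrite mulr_ge0_le0 // subr_ge0.
  have h2 : w l * (c * s k l + s l k) <= w l * - (lam * (z k - z l)).
    by rewrite ler_wpM2l // ltW.
  have h3 : S^-1 * (lam * (z k - z l)) <= w l * (lam * (z k - z l)).
    by rewrite ler_wpM2r // mulr_ge0 // subr_ge0 ltW.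
  lra.
(* At most one of [pos k l] and [pos l k] is nonzero, so their sum is the distance of the two
   values, in the form that matches [diam_le_sum_edges]. *)
pose pos k l : R := Num.max 0 (z k - z l).
have pair_pos k l :
    w k * s k l + w l * s l k <= - (lam / S * (pos k l + pos l k)).
  have [zkl|/ltW zkl] := leP (z l) (z k).
    have := pair_le k l zkl; rewrite /pos (@max_r _ _ 0 (z k - z l)) ?subr_ge0 //.
    by rewrite (@max_l _ _ 0) ?subr_le0 // addr0.
  have := pair_le l k zkl; rewrite /pos (@max_r _ _ 0 (z l - z k)) ?subr_ge0 //.
  by rewrite (@max_l _ _ 0) ?subr_le0 // add0r addrC.
set T := ordered_sum _ _ _.
have TE : T = \sum_k \sum_l psi k l * (w k * s k l).
  by apply: eq_bigr => k _; rewrite mulr_sumr; apply: eq_bigr => l _; rewrite mulrCA.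
have TE' : T = \sum_k \sum_l psi k l * (w l * s l k).
  rewrite TE exchange_big /=; apply: eq_bigr => k _; apply: eq_bigr => l _.
  by rewrite psi_sym.
pose P := \sum_k \sum_l psi k l * pos k l.
have PE' : P = \sum_k \sum_l psi k l * pos l k.
  rewrite /P exchange_big /=; apply: eq_bigr => k _; apply: eq_bigr => l _.
  by rewrite psi_sym.
have TT : T + T <= - (lam / S * (P + P)).
  rewrite {1}TE TE' {2}PE' /P -!big_split /= mulr_sumr -sumrN.
  apply: ler_sum => k _; rewrite -!big_split /= mulr_sumr -sumrN.
  apply: ler_sum => l _; rewrite -!mulrDr mulrCA -mulrN.
  exact: ler_wpM2l.
have PD : psi_l psi * diam z <= P := diam_le_sum_edges psi_ge0 N2 psi_conn z.
have : lam / S * (psi_l psi * diam z) <= lam / S * P.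
  by rewrite ler_wpM2l // divr_ge0 // ltW.
lra.
Qed.

Section Rates.
Variables (K lam : R).
Hypotheses (K0 : 0 < K) (lam0 : 0 <= lam).

Definition decay_rate : R := K / N%:R * psi_l psi * lam / geom_sum N c.

Lemma mean_coupling_le (s : 'I_N -> R) (e : R) k : (forall l, `|s l| <= e) ->
  `|K / N%:R * \sum_l psi k l * s l| <= K * psi_u psi * e.
Proof.
move=> se; have e0 : 0 <= e by apply: le_trans (se k).
have Nn0 : 0 < N%:R :> R by rewrite ltr0n.
have Kn : 0 <= K / N%:R by rewrite divr_ge0 ?ltW.
rewrite normrM (ger0_norm Kn).
have -> : K * psi_u psi * e = K / N%:R * (\sum_(l < N) psi_u psi * e).
  by rewrite sumr_const card_ord -mulr_natr; field; rewrite gt_eqF.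
apply: ler_wpM2l => //.
apply: le_trans (ler_norm_sum _ _ _) _; apply: ler_sum => l _.
rewrite normrM ger0_norm //; apply: ler_pM => //.
exact: (psi_u_ge N2 psi_conn).
Qed.

(** The coupling [s] is compared with a dissipative [s']: the latter contributes the decay, the
    error averages to at most [K * psi_u psi * e], and [h] stays as forcing. In the applications [s]
    is built from the unshifted variable and [s'] from the shifted one. *)
Lemma ordered_sum_rate z s s' h (p : {perm 'I_N}) (e : R) :
  (forall t, ordered_sum c t z <= ordered_sum c p z) ->
  dissipative lam z s' -> (forall k l, `|s k l - s' k l| <= e) ->
  ordered_sum c p (fun k => h k + K / N%:R * \sum_l psi k l * s k l)
    <= ordered_sum c p h - decay_rate * diam z + K * psi_u psi * e.
Proof.
move=> pmax s'P se.
pose d k l := s k l - s' k l.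
have -> : ordered_sum c p (fun k => h k + K / N%:R * \sum_l psi k l * s k l) =
    ordered_sum c p h
    + K / N%:R * ordered_sum c p (fun k => \sum_l psi k l * s' k l)
    + ordered_sum c p (fun k => K / N%:R * \sum_l psi k l * d k l).
  rewrite /ordered_sum mulr_sumr -!big_split; apply: eq_bigr => k _ /=.
  rewrite mulrCA -!mulrDr -addrA; congr (_ * (_ + _)).
  rewrite -mulrDr -big_split; congr (_ * _); apply: eq_bigr => l _ /=.
  by rewrite -mulrDr /d addrC subrK.
apply: lerD; first apply: lerD => //.
  have := ordered_sum_coupling lam0 pmax s'P.
  have Kn : 0 <= K / N%:R by rewrite divr_ge0 ?ler0n // ltW.
  by move=> /(ler_wpM2l Kn); rewrite mulrN /decay_rate !mulrA.
apply: (ordered_sum_le c2 N2) => k.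
exact: le_trans (ler_norm _) (mean_coupling_le k (se k)).
Qed.

Lemma decay_rate_gt0 : 0 < lam -> 0 < decay_rate.
Proof.
by move=> lam_gt0; rewrite !(divr_gt0, mulr_gt0) ?ltr0n // (psi_l_gt0 N2 psi_conn).
Qed.

Lemma decay_rate_le mu : lam <= mu -> decay_rate <= K * psi_u psi * mu.
Proof.
move=> lamu; have mu0 := le_trans lam0 lamu.
have pu0 := psi_u_gt0 N2 psi_conn; have pl0 := psi_l_gt0 N2 psi_conn.
rewrite /decay_rate ler_pdivrMr //.
apply: (@le_trans _ _ (K * psi_u psi * mu)); last first.
  by apply: ler_peMr; [rewrite !mulr_ge0 // ltW|exact: geom_sum_ge1].
apply: ler_pM => //; last (apply: ler_pM => //).
- by rewrite !mulr_ge0 ?invr_ge0 // ltW.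
- by rewrite divr_ge0 ?ler0n // ltW.
- exact: ltW.
- by rewrite ler_pdivrMr ?ltr0n // ler_peMr ?ler1n // ltW.
- exact: psi_lu.
Qed.

Lemma force_diff_le (mu A : R) (x h : 'I_N -> R) (s : 'I_N -> 'I_N -> R) i j :
  diam h <= A -> (forall k l, `|s k l| <= mu * diam x) ->
  (h i + K / N%:R * \sum_l psi i l * s i l)
    - (h j + K / N%:R * \sum_l psi j l * s j l) <=
  A + 2 * (K * psi_u psi * mu) * diam x.
Proof.
move=> hA sx; have hij : h i - h j <= A := le_trans (diam_ge h i j) hA.
have := mean_coupling_le i (sx i); have := mean_coupling_le j (sx j).
rewrite !ler_norml => /andP[si _] /andP[_ sj]; lra.
Qed.

End Rates.

Lemma decay_rate_mono (K lam lam' : R) : 0 < K -> lam <= lam' ->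
  decay_rate K lam <= decay_rate K lam'.
Proof.
move=> K0 lam_le; have pl0 := psi_l_gt0 N2 psi_conn.
rewrite /decay_rate ler_pM2r ?invr_gt0 // ler_pM2l //.
by rewrite !mulr_gt0 // invr_gt0 ltr0n.
Qed.

(** Converts smallness of [m * K] into the condition of [energy_rate]. The left side is quadratic in
    [mu] and the right side linear, whence [mu <= 1]. *)
Lemma decay_rate_small_inertia (m K mu r : R) : 0 < m -> 0 < K -> 0 < mu <= 1 ->
  m * K * (16 * N%:R * psi_u psi ^+ 2 * geom_sum N c) <= psi_l psi * r ->
  16 * m * (K * psi_u psi * mu) ^+ 2 <= decay_rate K (mu * r).
Proof.
move=> m0 K0 /andP[mu0 mu1] mK; have pu0 := psi_u_gt0 N2 psi_conn.
have n0 : 0 < N%:R :> R by rewrite ltr0n.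
have -> : decay_rate K (mu * r) = K * mu * (psi_l psi * r) / (N%:R * geom_sum N c).
  by rewrite /decay_rate; field; rewrite !gt_eqF.
rewrite ler_pdivlMr ?mulr_gt0 //.
set X := m * K * _ in mK.
have X0 : 0 <= X by rewrite ltW // !mulr_gt0 // exprn_gt0.
have -> : 16 * m * (K * psi_u psi * mu) ^+ 2 * (N%:R * geom_sum N c) = K * mu * (mu * X).
  by rewrite /X; ring.
rewrite ler_pM2l ?mulr_gt0 //; apply: le_trans mK; exact: ler_piMl.
Qed.

(* For x' = y and (x + m y)' = f, the left-hand side of the conclusion is the
   derivative of the energy that appears on its right-hand side. *)
Lemma energy_rate (K m lam mu A : R) (x y z h : 'I_N -> R)
    (s s' : 'I_N -> 'I_N -> R) (p q : {perm 'I_N}) (i j : 'I_N) :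
  let f k := h k + K / N%:R * \sum_l psi k l * s k l in
  let B := decay_rate K lam in let G := K * psi_u psi * mu in
  let kap := B / (2 * G) in
  0 < K -> 0 < m -> 0 < lam -> lam <= mu -> diam h <= A ->
  16 * m * G ^+ 2 <= B -> 2 * m * B <= 1 ->
  (forall k, z k = x k + m * y k) ->
  dissipative lam z s' -> dissipative lam (fun k => - z k) (fun k l => - s' k l) ->
  (forall k l, `|s k l - s' k l| <= mu * m * diam y) ->
  (forall k l, `|s k l| <= mu * diam x) ->
  (forall t, ordered_sum c t z <= ordered_sum c p z) ->
  (forall t, ordered_sum c q z <= ordered_sum c t z) ->
  (forall k l, y k - y l <= y i - y j) ->
  ordered_sum c p f - ordered_sum c q f
    + kap * ((f i - y i) - (f j - y j)) <=
  2 * A - B * (ordered_sum c p z - ordered_sum c q z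
    + kap * m * (y i - y j)).
Proof.
move=> f B G kap K0 m0 lam0 lamu hA mG mB zE s'P s'N se sx pmax qmin ymax.
have mu0 : 0 < mu := lt_le_trans lam0 lamu.
have pu0 := psi_u_gt0 N2 psi_conn.
have G0 : 0 < G by rewrite !mulr_gt0.
have B0 : 0 < B := decay_rate_gt0 K0 lam0.
have BG : B <= G := decay_rate_le K0 (ltW lam0) lamu.
(* [kap] is chosen so that the term [2 * G * diam x] of the force difference costs [B * diam x]. Up
   to a term in [m * diam y], this is half of the dissipation [2 * B * diam z] supplied by the two
   orderings. *)
have kapG : 2 * G * kap = B by rewrite mulrC divfK // gt_eqF // mulr_gt0.
have kap0 : 0 < kap by apply: divr_gt0 => //; apply: mulr_gt0.
have kap1 : kap <= 1.
  by rewrite ler_pdivrMr; [lra|apply: mulr_gt0].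
have kapm : 8 * m * G <= kap.
  by rewrite ler_pdivlMr; [move: mG; rewrite expr2; lra|apply: mulr_gt0].
have yD : diam y = y i - y j.
  by apply/eqP; rewrite eq_le diam_ge diam_le.
have D0 := diam_ge0 z N0; have Dy0 := diam_ge0 y N0.
have pq : ordered_sum c p z - ordered_sum c q z <= diam z.
  exact: ordered_sum_diff.
have hpq : ordered_sum c p h - ordered_sum c q h <= A.
  exact: le_trans (ordered_sum_diff c2 N2 _ _ _) hA.
have A0 : 0 <= A := le_trans (diam_ge0 h N0) hA.
have up := ordered_sum_rate K0 (ltW lam0) h pmax s'P se.
have lo : - ordered_sum c q f <=
    - ordered_sum c q h - B * diam z + K * psi_u psi * (mu * m * diam y).
  have qmax t : ordered_sum c t (fun k => - z k) <= ordered_sum c q (fun k => - z k).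
    by rewrite !ordered_sumN lerN2.
  have sNe k l : `|(- s k l) - (- s' k l)| <= mu * m * diam y.
    by rewrite -opprD normrN.
  have := ordered_sum_rate K0 (ltW lam0) (fun k => - h k) qmax s'N sNe.
  rewrite diam_opp // ordered_sumN -[X in _ -> X <= _]ordered_sumN.
  suff -> : (fun k => - h k + K / N%:R * \sum_l psi k l * - s k l) = (fun k => - f k).
    by [].
  apply/funext => k; rewrite /f opprD -mulrN -sumrN.
  by congr (_ + _ * _); apply: eq_bigr => l _; rewrite mulrN.
have xD : diam x <= diam z + m * diam y.
  apply: diam_le => // k l; have := diam_ge z k l.
  have : m * (y l - y k) <= m * diam y by rewrite ler_wpM2l ?diam_ge // ltW.
  by rewrite !zE; lra.
have fij : f i - f j <= A + 2 * G * diam x by apply: force_diff_le.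
have t1 : kap * (f i - f j) <= kap * A + B * (diam z + m * diam y).
  have h1 : kap * (f i - f j) <= kap * (A + 2 * G * diam x) by rewrite ler_wpM2l // ltW.
  have h2 : B * diam x <= B * (diam z + m * diam y) by rewrite ler_wpM2l // ltW.
  by rewrite -{1}kapG in h2; lra.
have t2 : kap * A <= A by rewrite ler_piMl.
have t3 : B * (ordered_sum c p z - ordered_sum c q z) <= B * diam z.
  by rewrite ler_wpM2l // ltW.
(* The damping [kap * diam y] is shared out: half pays for the velocity part [B * kap * m * diam y]
   of the energy, a quarter for the error [2 * G * m * diam y] of replacing [s] by [s'], and a
   quarter for the [B * m * diam y] left by bounding [diam x] through [diam z]. *)
have t4 : 2 * m * B * (kap * diam y) <= kap * diam y.
  by rewrite ler_piMl // mulr_ge0 // ltW.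
have t5 : 8 * m * G * diam y <= kap * diam y by rewrite ler_wpM2r.
have t6 : B * (m * diam y) <= 2 * G * (m * diam y).
  rewrite ler_wpM2r //; first by rewrite mulr_ge0 // ltW.
  by rewrite -kapG ler_piMr // mulr_ge0 // ltW.
rewrite -/B in up t3; rewrite -yD -/f in up t1 *.
have yij : kap * (f i - y i - (f j - y j)) = kap * (f i - f j) - kap * diam y.
  by rewrite yD; ring.
rewrite yij /G in t5 t6 *; lra.
Qed.

End Dissipation.

(** * Derivatives on the half-line *)

Section HalfLineDerivative.
Variable R : realType.
Implicit Types (f g : R -> R) (t l : R).

Lemma has_deriv_nonnegD f g t l k : has_deriv_nonneg f t l ->
  has_deriv_nonneg g t k -> has_deriv_nonneg (fun s => f s + g s) t (l + k).
Proof.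
move=> hf hg; rewrite /has_deriv_nonneg.
by under eq_fun do rewrite opprD addrACA mulrDl; exact: cvgD.
Qed.

Lemma has_deriv_nonnegM (b : R) f t l : has_deriv_nonneg f t l ->
  has_deriv_nonneg (fun s => b * f s) t (b * l).
Proof.
move=> hf; rewrite /has_deriv_nonneg.
by under eq_fun do rewrite -mulrBr -mulrA; apply: cvgM => //; exact: cvg_cst.
Qed.

Lemma has_deriv_nonnegB f g t l k : has_deriv_nonneg f t l ->
  has_deriv_nonneg g t k -> has_deriv_nonneg (fun s => f s - g s) t (l - k).
Proof.
move=> hf /(has_deriv_nonnegM (b := - 1)) hg.
have := has_deriv_nonnegD hf hg; rewrite mulN1r.
by congr has_deriv_nonneg; apply/funext => s; rewrite mulN1r.
Qed.

Lemma has_deriv_nonneg_cst (b : R) t : has_deriv_nonneg (fun=> b) t 0.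
Proof.
rewrite /has_deriv_nonneg; under eq_fun do rewrite subrr mul0r.
exact: cvg_cst.
Qed.

Lemma has_deriv_nonneg_sum (I : finType) (F : I -> R -> R) (d : I -> R) t :
  (forall i, has_deriv_nonneg (F i) t (d i)) ->
  has_deriv_nonneg (fun s => \sum_i F i s) t (\sum_i d i).
Proof.
move=> hF; elim: (index_enum I) => [|i r IH].
  by under eq_fun do rewrite big_nil; rewrite big_nil; apply: has_deriv_nonneg_cst.
by under eq_fun do rewrite big_cons; rewrite big_cons; apply: has_deriv_nonnegD.
Qed.

Lemma has_deriv_nonneg_eps f t l : has_deriv_nonneg f t l ->
  forall e, 0 < e -> exists2 d, 0 < d & forall s, 0 <= s -> `|s - t| < d ->
    `|f s - f t - l * (s - t)| <= e * `|s - t|.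
Proof.
move=> /cvgrPdist_le hf e e0; have := hf e e0.
rewrite near_withinE => /nbhs_ballP[d /= d0 hd]; exists d => // s s0 sd.
have [->|st] := eqVneq s t; first by rewrite !subrr mulr0 subrr normr0 mulr0.
have st0 : s - t != 0 by rewrite subr_eq0.
have := hd s; rewrite /ball /= distrC => /(_ sd st s0) h.
have -> : f s - f t - l * (s - t) = - (l - (f s - f t) / (s - t)) * (s - t) by field.
by rewrite normrM normrN ler_wpM2r.
Qed.

Lemma is_derive_has_deriv_nonneg f t l : is_derive t 1 f l -> has_deriv_nonneg f t l.
Proof.
move=> [fd <-]; apply/cvgrPdist_le => e e0.
have /cvgrPdist_le/(_ e e0) := fd.
move=> /nbhs_ballP[d /= d0 hd].
rewrite near_withinE; apply/nbhs_ballP; exists d => // s sd st _.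
have := hd (s - t); rewrite /ball /= sub0r normrN distrC => /(_ sd).
by rewrite subr_eq0 => /(_ st); rewrite /= [_ *: 1]mulr1 subrK mulrC.
Qed.

(** For [t > 0] the ball of radius [Num.min d t] stays in the half-line, so the restriction on the
    domain disappears. *)
Lemma has_deriv_nonneg_is_derive f t l : 0 < t -> has_deriv_nonneg f t l ->
  is_derive t 1 f l.
Proof.
move=> t0 /cvgrPdist_le hf.
have fl : ((fun h => h^-1 *: ((f \o shift t) (h *: 1) - f t)) @ 0^' --> l)%classic.
  apply/cvgrPdist_le => e e0; have := hf e e0.
  rewrite near_withinE => /nbhs_ballP[d /= d0 hd].
  apply/nbhs_ballP; exists (Num.min d t) => /=; first by rewrite lt_min d0.
  move=> h; rewrite /ball /= sub0r normrN lt_min => /andP[hd' ht] h0.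
  have := hd (h + t); rewrite /ball /= opprD addrCA subrr addr0 normrN => /(_ hd').
  rewrite -subr_eq0 addrK => /(_ h0); rewrite [_ *: 1]mulr1 mulrC; apply.
  by move: ht; rewrite ltr_norml => /andP[]; lra.
by apply: DeriveDef; [apply/cvg_ex; exists l|apply: cvg_lim].
Qed.

Lemma has_deriv_nonneg_near_lt0 f t l : has_deriv_nonneg f t l -> f t < 0 ->
  exists2 d, 0 < d & forall s, 0 <= s -> `|s - t| < d -> f s < 0.
Proof.
move=> /has_deriv_nonneg_eps /(_ 1 ltr01)[d d0 hd] ft.
have l1 : 0 < 1 + `|l| by rewrite ltr_pwDl.
exists (Num.min d (- f t / (1 + `|l|))).
  by rewrite lt_min d0 divr_gt0 // oppr_gt0.
move=> s s0; rewrite lt_min ltr_pdivlMr // => /andP[sd st].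
have := hd s s0 sd; rewrite mul1r => h.
have h1 : f s - f t - l * (s - t) <= `|s - t| := le_trans (ler_norm _) h.
have h2 : l * (s - t) <= `|l| * `|s - t| by rewrite -normrM ler_norm.
lra.
Qed.

(* A finite family of functions starting strictly below rho stays below rho as
   soon as, at a first contact, the touching member grows strictly slower. *)
Lemma barrier (J : finType) (a : R) (e e' : J -> R -> R) (rho rho' : R -> R) :
  0 <= a ->
  (forall j t, a <= t -> has_deriv_nonneg (e j) t (e' j t)) ->
  (forall t, a <= t -> has_deriv_nonneg rho t (rho' t)) ->
  (forall j, e j a < rho a) ->
  (forall t j, a <= t -> (forall k, e k t <= e j t) -> e j t = rho t ->
    e' j t < rho' t) ->
  forall t j, a <= t -> e j t < rho t.
Proof.
move=> a0 de drho ea contact t1 j1 at1; rewrite ltNge; apply/negP => ge1.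
pose phi j t := e j t - rho t.
have dphi j t : a <= t -> has_deriv_nonneg (phi j) t (e' j t - rho' t).
  by move=> at_; apply: has_deriv_nonnegB; [apply: de|apply: drho].
pose S := [set t | a <= t /\ exists j, 0 <= phi j t]%classic.
have S1 : S t1 by split=> //; exists j1; rewrite subr_ge0.
have lbS : lbound S a by move=> x [].
have hS : has_inf S by split; [exists t1|exists a].
set tau := inf S.
have atau : a <= tau by apply: lb_le_inf => //; exists t1.
have before s k : a <= s -> s < tau -> phi k s < 0.
  move=> as_ st; rewrite ltNge; apply/negP => h.
  have : tau <= s by apply: ge_inf; [exists a|split=> //; exists k].
  by rewrite leNgt st.
(* The infimum of the contact times is itself one: otherwise the whole finite family would stay
   negative on a common neighbourhood of [tau]. *)
have [j0 j0P] : exists j, 0 <= phi j tau.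
  apply: contrapT => /forallNP neg.
  have neg' j : phi j tau < 0 by rewrite ltNge; apply/negP/neg.
  have /boolp.choice[d dP] : forall j, exists d, 0 < d /\
      forall s, 0 <= s -> `|s - tau| < d -> phi j s < 0.
    move=> j; have [d d0 dP] := has_deriv_nonneg_near_lt0 (dphi j tau atau) (neg' j).
    by exists d.
  pose dm := \big[Num.min/1]_j d j.
  have dm0 : 0 < dm by apply: lt_bigmin => // j _; case: (dP j).
  have [s [as_ [j js]] sd] := inf_adherent dm0 hS.
  have taus : tau <= s by apply: ge_inf; [exists a|split=> //; exists j].
  have sdj : `|s - tau| < d j.
    have dmj : dm <= d j by apply: bigmin_le.
    by rewrite ger0_norm ?subr_ge0 //; lra.
  by have := (dP j).2 s (le_trans a0 as_) sdj; rewrite ltNge js.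
have taua : a < tau.
  rewrite lt_neqAle atau andbT; apply/negP => /eqP ea'.
  by have := ea j0; rewrite ltNge -subr_ge0 ea' j0P.
have left_pt d : 0 < d -> exists s, [/\ a <= s, s < tau & `|s - tau| < d].
  move=> d0; exists (Num.max a (tau - d / 2)); split.
  - by rewrite le_max lexx.
  - by rewrite gt_max taua /= ltrBlDr ltrDl divr_gt0.
  - have h1 : tau - d / 2 <= Num.max a (tau - d / 2) by rewrite le_max lexx orbT.
    have h2 : Num.max a (tau - d / 2) <= tau by rewrite ge_max atau /=; lra.
    by rewrite ltr_norml; apply/andP; split; lra.
have tau0 := le_trans a0 atau.
have nonpos k : phi k tau <= 0.
  rewrite leNgt; apply/negP => pos.
  have hN := has_deriv_nonnegM (b := - 1) (dphi k tau atau).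
  have [|d d0 dP] := has_deriv_nonneg_near_lt0 hN; first by rewrite mulN1r oppr_lt0.
  have [s [as_ st sd]] := left_pt d d0.
  have := dP s (le_trans a0 as_) sd; rewrite mulN1r oppr_lt0.
  by apply/negP; rewrite -leNgt ltW // before.
have j0E : phi j0 tau = 0 by apply/eqP; rewrite eq_le nonpos j0P.
have slope : e' j0 tau - rho' tau < 0.
  rewrite subr_lt0; apply: contact => //; last by apply/eqP; rewrite -subr_eq0 -/(phi j0 tau) j0E.
  by move=> k; rewrite -(lerD2r (- rho tau)) -/(phi j0 tau) j0E; apply: nonpos.
(* Even with the full slope as tolerance, [0 <= phi j0 s] holds just to the left of [tau], against
   [before]. *)
have [|d d0 dP] := has_deriv_nonneg_eps (dphi j0 tau atau) (e := - (e' j0 tau - rho' tau)).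
  by rewrite oppr_gt0.
have [s [as_ st sd]] := left_pt d d0.
have := dP s (le_trans a0 as_) sd; have := before s j0 as_ st.
rewrite j0E subr0 (ltr0_norm (x := s - tau)) ?subr_lt0 // ler_norml => phis /andP[le_phis _].
by move: le_phis; rewrite /phi; lra.
Qed.

End HalfLineDerivative.

(** * The energy as the maximum of a finite family, and its barrier *)

Section Energy.
Variables (R : realType) (N : nat) (c : R) (psi : 'M[R]_N).
Hypothesis c2 : 2 < c.
Hypothesis N2 : (2 <= N)%N.

Let N0 : (0 < N)%N. Proof. exact: leq_trans N2. Qed.

(** One member of the family, indexed by two orderings and two agents. It is linear in [z] and [y],
    so it can be differentiated although the maximum over [J] need not be differentiable. *)
Definition energy (b : R) (z y : 'I_N -> R)
    (J : ({perm 'I_N} * {perm 'I_N}) * ('I_N * 'I_N)) : R :=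
  ordered_sum c J.1.1 z - ordered_sum c J.1.2 z + b * (y J.2.1 - y J.2.2).

Lemma eta_bounds : 0 < eta c < 1.
Proof.
have c0 : 0 < c by apply: lt_trans c2.
have h1 : 2 / c < 1 by rewrite ltr_pdivrMr // mul1r.
have h2 : 0 < 2 / c by rewrite divr_gt0.
by rewrite /eta; apply/andP; split; lra.
Qed.

Lemma energy_le b z y J : 0 <= b -> energy b z y J <= diam z + b * diam y.
Proof.
move=> b0; apply: lerD; first exact: ordered_sum_diff.
by rewrite ler_wpM2l // diam_ge.
Qed.

(** Each of the two orderings loses at most [diam z / c], which is where [eta c = 1 - 2 / c] comes
    from. *)
Lemma energy_ge b z y : exists J, eta c * diam z + b * diam y <= energy b z y J.
Proof.
have [p pP] := ordered_sum_top c2 N2 z.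
have [q qP] := ordered_sum_top c2 N2 (fun k => - z k).
have [i [j [yD _ _]]] := diam_attained y N0.
have [k [l [zD _ _]]] := diam_attained z N0.
exists ((p, q), (i, j)); rewrite /energy /= yD lerD2r.
have := pP k; have := qP l; rewrite diam_opp // ordered_sumN /eta zD; lra.
Qed.

Lemma energy_max b z y (J : ({perm 'I_N} * {perm 'I_N}) * ('I_N * 'I_N)) :
  0 < b -> (forall J', energy b z y J' <= energy b z y J) ->
  [/\ forall t, ordered_sum c t z <= ordered_sum c J.1.1 z,
      forall t, ordered_sum c J.1.2 z <= ordered_sum c t z &
      forall k l, y k - y l <= y J.2.1 - y J.2.2].
Proof.
case: J => [[p q] [i j]] /= b0 Jmax; split.
- by move=> t; have := Jmax ((t, q), (i, j)); rewrite /energy /= !lerD2r.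
- by move=> t; have := Jmax ((p, t), (i, j)); rewrite /energy /= lerD2r lerD2l lerN2.
- by move=> k l; have := Jmax ((p, q), (k, l)); rewrite /energy /= lerD2l ler_pM2l.
Qed.

Lemma ordered_sum_deriv (p : {perm 'I_N}) (z : R -> 'I_N -> R) (f : 'I_N -> R) t :
  (forall k, has_deriv_nonneg (fun r => z r k) t (f k)) ->
  has_deriv_nonneg (fun r => ordered_sum c p (z r)) t (ordered_sum c p f).
Proof.
by move=> df; apply: has_deriv_nonneg_sum => k; apply: has_deriv_nonnegM.
Qed.

Hypothesis psi_ge0 : forall i j, 0 <= psi i j.
Hypothesis psi_sym : symmetric_network psi.
Hypothesis psi_conn : connected_network psi.

(** Feeds [energy_rate] to [barrier]. Dissipativity is required only while
    [eta c * diam (z t) <= rho t], which holds at a contact because the energy then equals [rho].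
    The lemma serves twice, for the phases and for the velocities. *)
Lemma energy_barrier (K m lam mu A a : R) (x y z h : R -> 'I_N -> R)
    (s s' : R -> 'I_N -> 'I_N -> R) (rho rho' : R -> R) :
  let f t k := h t k + K / N%:R * \sum_l psi k l * s t k l in
  let B := decay_rate c psi K lam in let G := K * psi_u psi * mu in
  let kap := B / (2 * G) in
  0 < K -> 0 < m -> 0 < lam -> lam <= mu ->
  16 * m * G ^+ 2 <= B -> 2 * m * B <= 1 -> 0 <= a ->
  (forall t k, z t k = x t k + m * y t k) ->
  (forall t k, a <= t -> has_deriv_nonneg (fun r => z r k) t (f t k)) ->
  (forall t k, a <= t ->
    has_deriv_nonneg (fun r => y r k) t ((f t k - y t k) / m)) ->
  (forall t, a <= t -> diam (h t) <= A) ->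
  (forall t, a <= t -> eta c * diam (z t) <= rho t ->
    dissipative c lam (z t) (s' t) /\
    dissipative c lam (fun k => - z t k) (fun k l => - s' t k l)) ->
  (forall t k l, a <= t -> `|s t k l - s' t k l| <= mu * m * diam (y t)) ->
  (forall t k l, a <= t -> `|s t k l| <= mu * diam (x t)) ->
  (forall t, a <= t -> has_deriv_nonneg rho t (rho' t)) ->
  diam (z a) + m * diam (y a) < rho a ->
  (forall t, a <= t -> 2 * A - B * rho t < rho' t) ->
  forall t, a <= t -> eta c * diam (z t) + kap * m * diam (y t) < rho t.
Proof.
move=> f B G kap K0 m0 lam0 lamu mG mB a0 zE dz dy hA sP se sx drho rho_a rho_lt.
have mu0 : 0 < mu := lt_le_trans lam0 lamu.
have pu0 := psi_u_gt0 N2 psi_conn.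
have G0 : 0 < G by rewrite !mulr_gt0.
have B0 : 0 < B := decay_rate_gt0 c2 N2 psi_conn K0 lam0.
have BG : B <= G := decay_rate_le c2 N2 psi_conn K0 (ltW lam0) lamu.
have kap0 : 0 < kap by apply: divr_gt0 => //; apply: mulr_gt0.
have kap1 : kap <= 1.
  by rewrite ler_pdivrMr; [lra|apply: mulr_gt0].
pose e J t := energy (kap * m) (z t) (y t) J.
pose e' (J : ({perm 'I_N} * {perm 'I_N}) * ('I_N * 'I_N)) t :=
  ordered_sum c J.1.1 (f t) - ordered_sum c J.1.2 (f t)
  + kap * m * ((f t J.2.1 - y t J.2.1) / m - (f t J.2.2 - y t J.2.2) / m).
have km0 : 0 < kap * m by rewrite mulr_gt0.
suff main t J : a <= t -> e J t < rho t.
  by move=> t at_; have [J /le_lt_trans] := energy_ge (kap * m) (z t) (y t); apply; apply: main.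
apply: (@barrier _ _ a e e' rho rho') => //.
- move=> {t}J t at_; apply: has_deriv_nonnegD.
    by apply: has_deriv_nonnegB; apply: ordered_sum_deriv => k; apply: dz.
  by apply: has_deriv_nonnegM; apply: has_deriv_nonnegB; apply: dy.
- move=> {t}J; apply: le_lt_trans (energy_le _ _ _ _) _; first exact: ltW.
  apply: le_lt_trans rho_a; rewrite lerD2l -mulrA ler_piMl // mulr_ge0 ?diam_ge0 //.
  exact: ltW.
- move=> {}t {}J at_ Jmax eJ.
  have [pmax qmin ymax] := energy_max km0 Jmax.
  have Dz : eta c * diam (z t) <= rho t.
    have [J' J'P] := energy_ge (kap * m) (z t) (y t).
    have : 0 <= kap * m * diam (y t) by rewrite mulr_ge0 ?diam_ge0 // ltW.
    by have := Jmax J'; rewrite eJ /e; lra.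
  have [s'P s'N] := sP t at_ Dz.
  have := energy_rate c2 N2 psi_ge0 psi_sym psi_conn K0 m0 lam0 lamu (hA t at_)
    mG mB (zE t) s'P s'N (fun k l => se t k l at_) (fun k l => sx t k l at_)
    pmax qmin ymax.
  rewrite -/B -/G -/kap -/(energy (kap * m) (z t) (y t) J) -/(e J t) eJ => le_e.
  apply: le_lt_trans (rho_lt t at_); apply: le_trans le_e.
  have m_neq0 : m != 0 by rewrite gt_eqF.
  rewrite /e' [X in _ + X <= _](_ : _ = kap * (f t J.2.1 - y t J.2.1 - (f t J.2.2 - y t J.2.2))) //.
  by field.
Qed.

End Energy.

(** * Sine estimates and exponentially decaying barriers *)

Section Analysis.
Variable R : realType.
Implicit Types a b x y : R.

Lemma sin_mvt x y : x <= y ->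
  exists2 w, w \in `[x, y] & sin y - sin x = cos w * (y - x).
Proof.
move=> xy; apply: MVT_segment => //; exact/continuous_subspaceT/continuous_sin.
Qed.

Lemma sin_dist x y : `|sin x - sin y| <= `|x - y|.
Proof.
wlog xy : x y / y <= x.
  by move=> H; have [/H //|/ltW/H] := leP y x; rewrite distrC [leRHS]distrC.
have [w _ ->] := sin_mvt xy; rewrite normrM ler_piMl //.
by rewrite ler_norml cos_geN1 cos_le1.
Qed.

(** Concavity of the sine: its mean slopes over [[0, x]] and [[x, g]] are cosines at points
    [u <= w], and the cosine decreases there. *)
Lemma sin_chord g x : 0 < g < pi -> 0 <= x <= g -> sin g / g * x <= sin x.
Proof.
move=> /andP[g0 gpi] /andP[x0 xg].
have [u] := sin_mvt x0; have [w] := sin_mvt xg.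
rewrite !in_itv /= sin0 !subr0 => /andP[xw wg] hw /andP[u0 ux] hu.
have cuw : cos w <= cos u.
  have : u <= w by apply: le_trans xw.
  rewrite le_eqVlt => /orP[/eqP ->//|uw].
  by rewrite ltW // ltr_cos // in_itv /=; apply/andP; split; lra.
rewrite mulrAC ler_pdivrMr //.
have : 0 <= (g - x) * x * (cos u - cos w) by rewrite !mulr_ge0 ?subr_ge0.
move: hw hu; nra.
Qed.

Lemma has_deriv_nonneg_sin (f : R -> R) t l : 0 < t -> has_deriv_nonneg f t l ->
  has_deriv_nonneg (fun s => sin (f s)) t (cos (f t) * l).
Proof.
move=> t0 /(has_deriv_nonneg_is_derive t0) df; exact: is_derive_has_deriv_nonneg.
Qed.

(** The solution of [rho' = - b (rho - P)] that starts from [P + M] at time [a]. *)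
Definition exp_decay (P M b a t : R) : R := P + M * expR (- (b * (t - a))).

Lemma exp_decay_deriv P M b a t :
  has_deriv_nonneg (exp_decay P M b a) t (- (b * (exp_decay P M b a t - P))).
Proof.
rewrite [X in _ (X - _)]/exp_decay [P + _]addrC addrK.
apply: is_derive_has_deriv_nonneg.
have dg : is_derive t 1 (fun r => - (b * (r - a))) (- b).
  by apply: is_derive_eq; rewrite subr0 [_ *: _]mulr1.
have := is_derive1_comp (is_derive_expR _) dg => de.
apply: is_derive_eq; rewrite add0r mul1r [_ *: _]mulrA; ring.
Qed.

Lemma exp_decay_start P M b a : exp_decay P M b a a = P + M.
Proof. by rewrite /exp_decay subrr mulr0 oppr0 expR0 mulr1. Qed.

Lemma exp_decay_le P M b a t t' : 0 <= M -> 0 <= b -> t <= t' ->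
  exp_decay P M b a t' <= exp_decay P M b a t.
Proof.
move=> M0 b0 tt'; rewrite lerD2l ler_wpM2l // ler_expR lerN2 ler_wpM2l //.
by rewrite lerD2r.
Qed.

Lemma exp_decay_lim P M b a d : 0 < M -> 0 < b -> P < d ->
  exists2 T, a < T & exp_decay P M b a T <= d.
Proof.
move=> M0 b0 Pd; have e0 : 0 < d - P by rewrite subr_gt0.
(* At this time the exponent is [- u] with [u = M / (d - P)], and [u <= expR u] gives
   [M * expR (- u) <= d - P]. *)
exists (a + M / (d - P) / b); first by rewrite ltrDl !divr_gt0.
rewrite /exp_decay addrAC subrr add0r [b * _]mulrC divfK ?gt_eqF //.
set u := M / (d - P); have u0 : 0 < u by rewrite divr_gt0.
rewrite -lerBrDl expRN ler_pdivrMr ?expR_gt0 //.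
have h : (d - P) * u <= (d - P) * expR u.
  by rewrite ler_pM2l //; apply: le_trans (expR_ge1Dx u); rewrite lerDr.
by rewrite /u mulrC divfK ?gt_eqF in h.
Qed.

End Analysis.

(** * The Kuramoto system *)

Section Kuramoto.
Variables (R : realType) (N : nat) (m K alpha c : R).
Variables (Omega : 'I_N -> R) (psi : 'M[R]_N).
Hypothesis m0 : 0 < m.
Hypothesis K0 : 0 < K.
Hypothesis c2 : 2 < c.
Hypothesis N2 : (2 <= N)%N.
Hypothesis psi_ge0 : forall i j, 0 <= psi i j.
Hypothesis psi_sym : symmetric_network psi.
Hypothesis psi_conn : connected_network psi.
Hypotheses (sin_alpha : 0 < sin alpha) (cos_alpha : 0 < cos alpha).

Let N0 : (0 < N)%N. Proof. exact: leq_trans N2. Qed.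

Implicit Type th : 'I_N -> R.

Definition force th (i : 'I_N) : R :=
  Omega i + K / N%:R * \sum_j psi i j * sin (th j - th i + alpha).

(** The addition formula splits the coupling into parts odd and even in the phase difference. The
    odd part dissipates; the even part joins the natural frequencies as bounded forcing. *)
Definition drift th (i : 'I_N) : R :=
  Omega i + K / N%:R * \sum_j psi i j * (sin alpha * cos (th j - th i)).

Let A : R := diam Omega + 2 * K * psi_u psi * sin alpha.

Lemma force_split th i : force th i =
  drift th i + K / N%:R * \sum_j psi i j * (cos alpha * sin (th j - th i)).
Proof.
rewrite /force /drift -addrA -mulrDr -big_split /=.
by congr (_ + _ * _); apply: eq_bigr => j _; rewrite sinD; ring.
Qed.

Lemma drift_diam th : diam (drift th) <= A.
Proof.
apply: diam_le => // i j.
have bnd k l : `|sin alpha * cos (th l - th k)| <= sin alpha.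
  by rewrite normrM gtr0_norm // ler_piMr ?cos_max // ltW.
have := mean_coupling_le N2 psi_ge0 psi_conn K0 i (bnd i).
have := mean_coupling_le N2 psi_ge0 psi_conn K0 j (bnd j).
rewrite !ler_norml => /andP[si _] /andP[_ sj].
by have := diam_ge Omega i j; rewrite /A /drift; lra.
Qed.

Lemma sin_coupling_le th k l :
  `|cos alpha * sin (th l - th k)| <= cos alpha * diam th.
Proof.
rewrite normrM gtr0_norm // ler_pM2l //; apply: le_trans (diam_norm th l k).
by have := sin_dist (th l - th k) 0; rewrite sin0 !subr0.
Qed.

Lemma force_diam th : diam (force th) <= A + 2 * (K * psi_u psi * cos alpha) * diam th.
Proof.
apply: diam_le => // i j; rewrite !force_split.
exact: (force_diff_le N2 psi_ge0 psi_conn K0 (mu := cos alpha) i j (drift_diam th) (sin_coupling_le th)).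
Qed.

(** The sine is odd, so with [d = z k - z l] the combination [c * s k l + s l k] is
    [- (c - 1) * mu * sin d]. As [2 < c], at least [mu * sin d] is left, and the chord bound makes
    it linear in [d]. *)
Lemma dissipative_sin (g mu : R) (z : 'I_N -> R) : 0 <= mu -> 0 < g < pi -> diam z <= g ->
  dissipative c (mu * (sin g / g)) z (fun k l => mu * sin (z l - z k)).
Proof.
move=> mu0 g0 zg k l zlk; set d := z k - z l.
have d0 : 0 <= d <= g by rewrite subr_ge0 zlk /= (le_trans (diam_ge z k l)).
have sd := sin_chord g0 d0.
have -> : z l - z k = - d by rewrite opprB.
rewrite sinN; have sd0 : 0 <= sin d.
  by case/andP: g0 => *; case/andP: d0 => *; apply: sin_ge0_pi; apply/andP; split; lra.
have h1 : 0 <= mu * sin d by rewrite mulr_ge0.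
have h2 : mu * (sin g / g * d) <= mu * sin d by rewrite ler_wpM2l.
have h3 : 0 <= (c - 2) * (mu * sin d) by rewrite mulr_ge0 // subr_ge0 ltW.
by split; lra.
Qed.

(** * Phase and velocity estimates along a solution *)

Section Solution.
Implicit Type t : R.
Variables (theta omega : R -> 'I_N -> R).
Hypothesis sol : kuramoto_solution m K alpha Omega psi theta omega.

Lemma solution_theta t i : 0 <= t ->
  has_deriv_nonneg (fun s => theta s i) t (omega t i).
Proof. by move=> t0; have [] := sol i t0. Qed.

Lemma solution_omega t i : 0 <= t ->
  has_deriv_nonneg (fun s => omega s i) t ((force (theta t) i - omega t i) / m).
Proof.
move=> t0; have [_ [a da E]] := sol i t0.
suff -> : (force (theta t) i - omega t i) / m = a by [].
by rewrite /force -E addrK mulrC mulKf // gt_eqF.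
Qed.

Let shifted t i := theta t i + m * omega t i.

Lemma solution_shifted t i : 0 <= t ->
  has_deriv_nonneg (fun s => shifted s i) t (force (theta t) i).
Proof.
move=> t0; have := has_deriv_nonnegD (solution_theta (i := i) t0)
  (has_deriv_nonnegM (b := m) (solution_omega (i := i) t0)).
by rewrite mulrCA divff ?gt_eqF // mulr1 addrC subrK.
Qed.

Lemma shifted_diam t : diam (shifted t) <= diam (theta t) + m * diam (omega t).
Proof.
apply: diam_le => // i j; rewrite /shifted.
have := diam_ge (theta t) i j.
have : m * (omega t i - omega t j) <= m * diam (omega t) by rewrite ler_pM2l ?diam_ge.
lra.
Qed.

Lemma theta_diam t : diam (theta t) <= diam (shifted t) + m * diam (omega t).
Proof.
apply: diam_le => // i j; have := diam_ge (shifted t) i j; rewrite /shifted.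
have : m * (omega t j - omega t i) <= m * diam (omega t) by rewrite ler_pM2l ?diam_ge.
lra.
Qed.

(** The barrier falls from [beta] towards [P]. Staying below [beta <= eta c * g] keeps the shifted
    diameter within [g], where the chord bound holds, and [2 * A < B * P] gives the strict
    differential inequality. *)
Lemma phase_energy_decay (g beta P : R) :
  let lam := cos alpha * (sin g / g) in
  let B := decay_rate c psi K lam in let G := K * psi_u psi * cos alpha in
  let kap := B / (2 * G) in
  0 < g < pi -> 16 * m * G ^+ 2 <= B -> 2 * m * B <= 1 ->
  beta <= eta c * g -> 0 <= P -> P < beta -> 2 * A < B * P ->
  diam (theta 0) + 2 * m * diam (omega 0) < beta ->
  forall t, 0 <= t -> eta c * diam (shifted t) + kap * m * diam (omega t)
    < exp_decay P (beta - P) B 0 t.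
Proof.
move=> lam B G kap gpi mG mB betag P0 Pbeta AP init.
have [g0 gpi'] := andP gpi; have sg : 0 < sin g by apply: sin_gt0_pi.
have lam0 : 0 < lam by apply: mulr_gt0 => //; apply: divr_gt0.
have lam_le : lam <= cos alpha.
  apply: ler_piMr; first exact: ltW.
  rewrite ler_pdivrMr // mul1r.
  by have := le_trans (ler_norm _) (sin_dist g 0); rewrite sin0 !subr0 gtr0_norm.
have B0 : 0 < B := decay_rate_gt0 c2 N2 psi_conn K0 lam0.
have [eta0 eta1] := andP (eta_bounds c2).
have rho_le t : 0 <= t -> exp_decay P (beta - P) B 0 t <= beta.
  move=> t0; have := exp_decay_le P 0 (M := beta - P) _ (ltW B0) t0.
  by rewrite exp_decay_start subrKC; apply; rewrite subr_ge0 ltW.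
have sP t : 0 <= t -> eta c * diam (shifted t) <= exp_decay P (beta - P) B 0 t ->
    diam (shifted t) <= g.
  move=> t0 h; rewrite -(ler_pM2l eta0).
  exact: le_trans h (le_trans (rho_le t t0) betag).
pose s (t : R) k l := cos alpha * sin (theta t l - theta t k).
pose s' t k l := cos alpha * sin (shifted t l - shifted t k).
apply: (@energy_barrier _ _ _ _ c2 N2 psi_ge0 psi_sym psi_conn K m lam (cos alpha) A 0
  theta omega shifted (fun t => drift (theta t)) s s'
  (exp_decay P (beta - P) B 0) (fun t => - (B * (exp_decay P (beta - P) B 0 t - P)))) => //.
- by move=> t k t0; rewrite -force_split; apply: solution_shifted.
- by move=> t k t0; rewrite -force_split; apply: solution_omega.
- by move=> t _; apply: drift_diam.
- move=> t t0 /(sP t t0) zg; split; first by apply: dissipative_sin => //; apply: ltW.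
  have -> : (fun k l => - s' t k l) =
      (fun k l => cos alpha * sin (- shifted t l - - shifted t k)).
    apply/funext => k; apply/funext => l; rewrite /s' -mulrN -sinN.
    by congr (_ * sin _); ring.
  by apply: (@dissipative_sin _ _ (fun k => - shifted t k)); rewrite ?diam_opp // ltW.
- move=> t k l _; rewrite /s /s' -mulrBr normrM gtr0_norm // -mulrA ler_pM2l //.
  apply: le_trans (sin_dist _ _) _.
  have -> : theta t l - theta t k - (shifted t l - shifted t k)
      = m * (omega t k - omega t l) by rewrite /shifted; ring.
  by rewrite normrM gtr0_norm // ler_pM2l // diam_norm.
- by move=> t k l _; apply: sin_coupling_le.
- by move=> t _; apply: exp_decay_deriv.
- rewrite exp_decay_start subrKC; apply: le_lt_trans init.
  by have := shifted_diam 0; lra.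
- move=> t _; rewrite -/B; lra.
Qed.

(** Since [diam theta] is at most [d + m * diam omega], the velocity feeds back into the force by at
    most [2 * G * m * rho <= rho / 8]. At contact the force difference is below
    [7 / 8 * P + rho / 8], so the slope is below [- 7 / 8 * (rho - P) / m], steeper than the barrier
    of rate [1 / (2 m)]. *)
Lemma velocity_relaxation (t1 d P Y : R) : let G := K * psi_u psi * cos alpha in
  0 <= t1 -> 16 * m * G <= 1 -> 0 < Y -> 0 < P -> A + 2 * G * d < 7 / 8 * P ->
  (forall t, t1 <= t -> diam (shifted t) <= d) -> diam (omega t1) < P + Y ->
  forall t, t1 <= t -> diam (omega t) < exp_decay P Y (2 * m)^-1 t1 t.
Proof.
move=> G t10 mG Y0 P0 AP zd w1 t t1t.
pose rho := exp_decay P Y (2 * m)^-1 t1.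
suff main J : omega t J.1 - omega t J.2 < rho t.
  have [i [j [-> _ _]]] := diam_attained (omega t) N0; exact: (main (i, j)).
pose e (J : 'I_N * 'I_N) t := omega t J.1 - omega t J.2.
pose e' (J : 'I_N * 'I_N) t :=
  (force (theta t) J.1 - omega t J.1) / m - (force (theta t) J.2 - omega t J.2) / m.
apply: (@barrier _ _ t1 e e' rho (fun t => - ((2 * m)^-1 * (rho t - P)))) => //.
- move=> {t t1t}J t t1t; have t0 := le_trans t10 t1t.
  by apply: has_deriv_nonnegB; apply: solution_omega.
- by move=> {t t1t}t _; apply: exp_decay_deriv.
- by move=> {}J; rewrite /rho exp_decay_start; apply: le_lt_trans w1; apply: diam_ge.
- move=> {t t1t J}t [i j] t1t Jmax eJ.
  have wD : diam (omega t) <= rho t.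
    by rewrite -eJ; apply: diam_le => // k l; apply: (Jmax (k, l)).
  have rhoP : P <= rho t by rewrite lerDl mulr_ge0 ?expR_ge0 // ltW.
  have thD : diam (theta t) <= d + m * rho t.
    apply: le_trans (theta_diam t) _; apply: lerD; first exact: zd.
    by rewrite ler_pM2l.
  have G0 : 0 < G by rewrite !mulr_gt0 // (psi_u_gt0 N2 psi_conn).
  have fij := le_trans (diam_ge (force (theta t)) i j) (force_diam (theta t)).
  have h1 : 2 * G * diam (theta t) <= 2 * G * (d + m * rho t).
    by rewrite ler_pM2l // mulr_gt0.
  have h2 : 16 * m * G * rho t <= rho t.
    by rewrite ler_piMl // (le_trans _ rhoP) // ltW.
  have -> : e' (i, j) t = (force (theta t) i - force (theta t) j - rho t) / m.
    by rewrite -eJ /e' /e /=; field; rewrite gt_eqF.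
  have -> : - ((2 * m)^-1 * (rho t - P)) = - ((rho t - P) / 2) / m.
    by field; rewrite gt_eqF.
  by rewrite ltr_pM2r ?invr_gt0 //; move: fij; rewrite -/G; lra.
Qed.

(** The time derivative of [sin (th l - th k + alpha)] when [w] is the velocity of [th]. *)
Definition slope (th w : 'I_N -> R) (k l : 'I_N) : R :=
  cos (th l - th k + alpha) * (w l - w k).

Lemma force_deriv t k : 0 < t ->
  has_deriv_nonneg (fun s => force (theta s) k) t
    (0 + K / N%:R * \sum_l psi k l * slope (theta t) (omega t) k l).
Proof.
move=> t0; apply: has_deriv_nonnegD; first exact: has_deriv_nonneg_cst.
apply/has_deriv_nonnegM/has_deriv_nonneg_sum => l; apply: has_deriv_nonnegM.
apply: has_deriv_nonneg_sin => //; rewrite -[_ - _]addr0.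
apply: has_deriv_nonnegD (has_deriv_nonneg_cst _ _).
by apply: has_deriv_nonnegB; apply: solution_theta; apply: ltW.
Qed.

(** [energy_barrier] one derivative higher: [x] is [omega], [y] is the acceleration [v], and
    [z = omega + m v] is the force, with [lam = mu = 1] and zero forcing. Recovering [omega] as
    [z - m v] produces the factor [(eta c)^-1 + kap^-1]; halving the rate makes the differential
    inequality strict. *)
Lemma velocity_energy_decay (t2 D C M : R) :
  let B := decay_rate c psi K 1 in let G := K * psi_u psi * 1 in
  let kap := B / (2 * G) in
  0 < t2 -> 16 * m * G ^+ 2 <= B -> 2 * m * B <= 1 -> 2 <= c * C -> 0 <= C ->
  (forall t, t2 <= t -> diam (theta t) <= D) ->
  (forall x, `|x| <= D -> C <= cos (x + alpha)) -> 0 < M ->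
  2 * diam (force (theta t2)) + diam (omega t2) < M ->
  forall t, t2 <= t ->
    diam (omega t) <= ((eta c)^-1 + kap^-1) * exp_decay 0 M (B / 2) t2 t.
Proof.
move=> B G kap t20 mG mB cC C0 thD cosC M0 init t t2t.
have lam0 : 0 < 1 :> R by [].
have B0 : 0 < B := decay_rate_gt0 c2 N2 psi_conn K0 lam0.
have G0 : 0 < G by rewrite !mulr_gt0 // (psi_u_gt0 N2 psi_conn).
have kap0 : 0 < kap by apply: divr_gt0 => //; apply: mulr_gt0.
have [eta0 eta1] := andP (eta_bounds c2).
pose v t k := (force (theta t) k - omega t k) / m.
pose z t := force (theta t).
pose w t k l := cos (theta t l - theta t k + alpha).
have wC s k l : t2 <= s -> C <= w s k l <= 1.
  move=> t2s; rewrite cos_le1 andbT; apply: cosC.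
  exact: le_trans (diam_norm _ _ _) (thD s t2s).
have w1 s k l : `|w s k l| <= 1 by apply: cos_max.
pose s' t k l := w t k l * (z t l - z t k).
pose rho := exp_decay 0 M (B / 2) t2.
have rho0 s : 0 < rho s by rewrite /rho /exp_decay add0r mulr_gt0 // expR_gt0.
have zE s k : z s k = omega s k + m * v s k.
  by rewrite /v mulrCA divff ?gt_eqF // mulr1 subrKC.
(* Because of [alpha], [w s k l] and [w s l k] may differ; both lie in [[C, 1]], so [c * C >= 2]
   leaves [c * w s k l - w s l k >= 1]. A general [z'] covers both [z] and its negative. *)
have dis s z' : t2 <= s ->
    dissipative c 1 z' (fun k l => w s k l * (z' l - z' k)).
  move=> t2s k l zlk; have /andP[Ck k1] := wC s k l t2s; have /andP[Cl l1] := wC s l k t2s.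
  have h0 : 0 <= z' k - z' l by rewrite subr_ge0.
  have h1 : 0 <= w s k l * (z' k - z' l) by rewrite mulr_ge0 // (le_trans C0).
  have h2 : w s l k * (z' k - z' l) <= 1 * (z' k - z' l) by rewrite ler_wpM2r.
  have h3 : 2 * (z' k - z' l) <= c * w s k l * (z' k - z' l).
    rewrite ler_wpM2r // (le_trans cC) // ler_wpM2l // ltW //.
    by rewrite (lt_trans _ c2).
  by split; lra.
have main : eta c * diam (z t) + kap * m * diam (v t) < rho t.
  apply: (@energy_barrier _ _ _ _ c2 N2 psi_ge0 psi_sym psi_conn K m 1 1 0 t2
    omega v z (fun _ _ => 0) (fun t => slope (theta t) (omega t)) s'
    rho (fun t => - (B / 2 * (rho t - 0)))) => //.
  - exact: ltW.
  - by move=> s k t2s; apply: force_deriv; apply: lt_le_trans t2s.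
  - move=> s k t2s; have s0 := lt_le_trans t20 t2s.
    rewrite [_ / m]mulrC; under eq_fun do rewrite /v mulrC.
    apply: has_deriv_nonnegM; apply: has_deriv_nonnegB; first exact: force_deriv.
    by apply: solution_omega; apply: ltW.
  - by move=> s _; apply: diam_le => // i j; rewrite subrr.
  - move=> s t2s _; split; first exact: dis.
    have := dis s (fun k => - z s k) t2s.
    congr dissipative; apply/funext => k; apply/funext => l.
    by rewrite /s'; ring.
  - move=> s k l _; rewrite mul1r /slope /s' -mulrBr normrM.
    have -> : omega s l - omega s k - (z s l - z s k) = m * (v s k - v s l).
      by rewrite !zE; ring.
    rewrite normrM (gtr0_norm m0); apply: (@le_trans _ _ (m * `|v s k - v s l|)).
      by apply: ler_piMl; [apply: mulr_ge0 => //; apply: ltW|exact: w1].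
    by rewrite ler_pM2l // diam_norm.
  - move=> s k l _; rewrite mul1r normrM.
    by apply: le_trans (diam_norm _ l k); apply: ler_piMl => //; apply: w1.
  - by move=> s _; apply: exp_decay_deriv.
  - rewrite /rho exp_decay_start add0r; apply: le_lt_trans init.
    suff : m * diam (v t2) <= diam (z t2) + diam (omega t2) by rewrite /z; lra.
    rewrite -ler_pdivlMl //; apply: diam_le => // i j; rewrite ler_pdivlMl //.
    have := diam_ge (z t2) i j; have := diam_ge (omega t2) j i.
    by rewrite !zE; lra.
  - move=> s _; rewrite -/B mulr0 subr0; have := rho0 s.
    by move=> /(mulr_gt0 B0); lra.
have Dz : diam (z t) <= rho t / eta c.
  rewrite ler_pdivlMr // mulrC; apply: ltW; apply: le_lt_trans main.
  have kDv : 0 <= kap * m * diam (v t) by apply: mulr_ge0; [apply/ltW/mulr_gt0|exact: diam_ge0].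
  by rewrite lerDl.
have Dv : m * diam (v t) <= rho t / kap.
  rewrite ler_pdivlMr // mulrC mulrA; apply: ltW; apply: le_lt_trans main.
  have eDz : 0 <= eta c * diam (z t) by apply: mulr_ge0; [exact: ltW|exact: diam_ge0].
  by rewrite lerDr.
apply: (@le_trans _ _ (diam (z t) + m * diam (v t))).
  apply: diam_le => // i j; have := diam_ge (z t) i j.
  have : m * (v t j - v t i) <= m * diam (v t) by rewrite ler_pM2l ?diam_ge.
  by rewrite !zE; lra.
by rewrite mulrDl ![_^-1 * _]mulrC; apply: lerD.
Qed.

End Solution.

(** The target [D] is split into [5 / 8 * D] for the shifted phases, reached by [t1], and
    [3 / 8 * D] for [m * diam omega], reached by [t2]. These times are fixed before the solution is
    introduced. *)
Lemma phase_locking (g beta D : R) (theta0 omega0 : 'I_N -> R) :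
  let lam := cos alpha * (sin g / g) in
  let B := decay_rate c psi K lam in let G := K * psi_u psi * cos alpha in
  0 < g < pi -> 16 * m * G ^+ 2 <= B -> 2 * m * B <= 1 ->
  beta <= eta c * g -> 0 < D -> D < beta -> 4 * A < B * (D * eta c) ->
  diam theta0 + 2 * m * diam omega0 < beta ->
  exists2 T, 0 < T & forall theta omega,
    kuramoto_solution m K alpha Omega psi theta omega ->
    theta 0 = theta0 -> omega 0 = omega0 ->
    forall t, T <= t -> diam (theta t) <= D /\ m * diam (omega t) <= 3 / 8 * D.
Proof.
move=> lam B G gpi mG mB betag D0 Dbeta AB init.
have [eta0 eta1] := andP (eta_bounds c2); have [g0 _] := andP gpi.
have lam0 : 0 < lam by apply: mulr_gt0 => //; apply: divr_gt0 => //; exact: sin_gt0_pi.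
have lam_le : lam <= cos alpha.
  apply: ler_piMr; [exact: ltW|rewrite ler_pdivrMr // mul1r].
  have := le_trans (ler_norm _) (sin_dist g 0).
  by rewrite sin0 !subr0 gtr0_norm.
have B0 : 0 < B := decay_rate_gt0 c2 N2 psi_conn K0 lam0.
have BG : B <= G := decay_rate_le c2 N2 psi_conn K0 (ltW lam0) lam_le.
have G0 : 0 < G by apply: lt_le_trans BG.
have De0 : 0 < D * eta c by rewrite mulr_gt0.
have DeD : D * eta c <= D by rewrite ler_piMr // ltW.
(* This level lies strictly below [5 / 8 * D * eta c] and turns the assumed bound on [A] into
   [2 * A < B * P]. *)
pose P := D * eta c / 2.
have P0 : 0 < P by rewrite divr_gt0.
have AP : 2 * A < B * P by rewrite /P mulrA ltr_pdivlMr //; lra.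
have Pbeta : P < beta by rewrite /P; lra.
have betaP : 0 < beta - P by rewrite subr_gt0.
have P_lt : P < eta c * (5 / 8 * D) by rewrite /P; lra.
have [t1 t10 t1P] := exp_decay_lim 0 betaP B0 P_lt.
pose kap := B / (2 * G).
have kap0 : 0 < kap by apply: divr_gt0 => //; apply: mulr_gt0.
(* The energy bound at [t1] is at most [beta], and [diam omega] enters it with the factor
   [kap * m]. *)
pose Y := beta / (kap * m).
have km0 : 0 < kap * m by rewrite mulr_gt0.
have Y0 : 0 < Y by apply: divr_gt0 => //; apply: lt_trans Dbeta.
pose Q := D / (4 * m).
have Q0 : 0 < Q by rewrite divr_gt0 // mulr_gt0.
have m20 : 0 < (2 * m)^-1 by rewrite invr_gt0 mulr_gt0.
have Q_lt : Q < 3 / 8 * D / m.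
  rewrite /Q ltr_pdivrMr ?mulr_gt0 //.
  have -> : 3 / 8 * D / m * (4 * m) = 3 / 2 * D by field; rewrite gt_eqF.
  by lra.
have [t2 t21 t2Q] := exp_decay_lim t1 Y0 m20 Q_lt.
have mG1 : 16 * m * G <= 1.
  rewrite -(ler_pM2r G0) mul1r; apply: le_trans BG; apply: le_trans mG.
  by rewrite expr2 mulrA.
(* After multiplication by [m], the forcing contributes less than [D / 8] and the coupling at most
   [5 / 64 * D], together below [14 / 64 * D]. *)
have AQ : A + 2 * G * (5 / 8 * D) < 7 / 8 * Q.
  rewrite -(ltr_pM2l m0).
  have -> : m * (7 / 8 * Q) = 7 / 32 * D by rewrite /Q; field; rewrite gt_eqF.
  have h1 : m * (4 * A) < m * (B * (D * eta c)) by rewrite ltr_pM2l.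
  have h2 : 2 * m * B * (D * eta c) <= D * eta c by rewrite ler_piMl // ltW.
  have h3 : 16 * m * G * D <= D by rewrite ler_piMl // ltW.
  by move: h1 h2 h3; lra.
exists t2; first exact: lt_trans t21.
move=> theta omega sol th0 om0; rewrite -th0 -om0 in init.
have phase := phase_energy_decay sol gpi mG mB betag (ltW P0) Pbeta AP init.
have phase1 s : t1 <= s -> diam (fun i => theta s i + m * omega s i) <= 5 / 8 * D.
  move=> t1s; rewrite -(ler_pM2l eta0); apply: le_trans t1P.
  apply: le_trans (exp_decay_le P 0 (ltW betaP) (ltW B0) t1s).
  apply: ltW; apply: le_lt_trans (phase s (le_trans (ltW t10) t1s)).
  by rewrite lerDl; apply: mulr_ge0; [exact: ltW|exact: diam_ge0].
have w1 : diam (omega t1) < Q + Y.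
  apply: (@lt_le_trans _ _ Y); last by rewrite lerDr ltW.
  rewrite ltr_pdivlMr //.
  have := exp_decay_le P 0 (ltW betaP) (ltW B0) (ltW t10).
  rewrite exp_decay_start subrKC.
  apply: lt_le_trans; apply: le_lt_trans (phase t1 (ltW t10)).
  by rewrite mulrC lerDr; apply: mulr_ge0; [exact: ltW|exact: diam_ge0].
have velocity := velocity_relaxation sol (ltW t10) mG1 Y0 Q0 AQ phase1 w1.
move=> s t2s; have t1s := le_trans (ltW t21) t2s.
have ws : m * diam (omega s) <= 3 / 8 * D.
  rewrite mulrC -ler_pdivlMr //; apply: le_trans t2Q.
  apply: le_trans (exp_decay_le Q t1 (ltW Y0) (ltW m20) t2s).
  exact/ltW/velocity.
split=> //; apply: le_trans (theta_diam theta omega s) _.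
by move: (phase1 s t1s) ws; lra.
Qed.

End Kuramoto.

(** * Verification of the parameter conditions and synthesis of the decay estimate *)

Theorem theorem1p1 (R : realType) (N : nat) (m K alpha : R)
    (Omega : 'I_N -> R) (psi : 'M[R]_N)
    (theta0 omega0 : 'I_N -> R) (beta gamma Dinf delta c : R)
    (hN : (2 <= N)%N) (hm : 0 < m) (hK : 0 < K)
    (halpha : 0 < alpha < pi / 2)
    (hpsi : forall i j, 0 <= psi i j)
    (hsym : symmetric_network psi) (hconn : connected_network psi)
    (hgamma0 : 0 < gamma) (hdelta0 : 0 < delta) (hc0 : 0 < c)
    (hbeta : 0 < beta < pi)
    (hinit : 2 * m * diam Omega + 4 * m * K * psi_u psi * sin alpha
             + (1 + 4 * m * K * psi_u psi * cos alpha) * diam theta0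
             + 3 * m * diam omega0 < beta)
    (hgamma : beta < gamma < pi)
    (hDinf : 0 < Dinf < Num.min (pi / 2) beta)
    (hdelta : alpha < delta < pi / 2 - Dinf)
    (hc : Num.max (2 / cos (Dinf + delta)) (2 / (1 - beta / gamma)) < c)
    (hmK : m * K <
       Num.min (eta c ^+ 2 * psi_l psi * sin gamma
                / (16 * N%:R * psi_u psi ^+ 2 * geom_sum N c * gamma))
               (N%:R * geom_sum N c / (2 * psi_l psi)))
    (hK1 : 4 * (diam Omega + 2 * K * psi_u psi * sin alpha)
             * N%:R * geom_sum N c * gamma
           / (Dinf * eta c * psi_l psi * cos alpha * sin gamma) < K)
    (hK2 : 64 * (diam Omega + 2 * K * psi_u psi * sin alpha)
             * (Dinf * cos alpha + sin alpha)
             * N%:R ^+ 3 * psi_u psi ^+ 2 * geom_sum N c ^+ 3 * gamma ^+ 2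
           / (eta c ^+ 3 * psi_l psi ^+ 3 * cos alpha * sin gamma ^+ 2) < K) :
  exists tstar C Lambda : R,
    [/\ 0 <= tstar, 0 < C, 0 < Lambda &
      forall theta omega : R -> 'I_N -> R,
        kuramoto_solution m K alpha Omega psi theta omega ->
        (forall i, theta 0 i = theta0 i /\ omega 0 i = omega0 i) ->
        forall t : R, tstar <= t ->
          diam (omega t) <= C * expR (- (Lambda * (t - tstar)))].
Proof.
have N0 : (0 < N)%N := leq_trans (ltn0Sn 1) hN.
have [alpha0 alpha_pi] := andP halpha; have pi0 := pi_gt0 R.
have sa0 : 0 < sin alpha by apply: sin_gt0_pihalf.
have ca0 : 0 < cos alpha.
  by apply: cos_gt0_pihalf; rewrite (lt_trans _ alpha0) ?oppr_lt0 ?divr_gt0.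
have [beta0 _] := andP hbeta; have [beta_gamma gamma_pi] := andP hgamma.
have gpi : 0 < gamma < pi by rewrite hgamma0.
have sg0 : 0 < sin gamma by apply: sin_gt0_pi.
have sg_le : sin gamma <= gamma.
  have := le_trans (ler_norm _) (sin_dist gamma 0).
  by rewrite sin0 !subr0 gtr0_norm.
move: hDinf; rewrite lt_min => /andP[Dinf0 /andP[_ Dinf_beta]].
have [alpha_delta delta_pi] := andP hdelta.
move: hc; rewrite gt_max => /andP[hcC hc_eta].
pose C := cos (Dinf + delta).
have C0 : 0 < C.
  by apply: cos_gt0_pihalf; clear -alpha0 alpha_delta delta_pi Dinf0 pi0; apply/andP; split; lra.
have cC : 2 <= c * C by move: hcC; rewrite ltr_pdivrMr // => /ltW.
(* Here [|x + alpha| < Dinf + delta < pi / 2], and the cosine is even and decreasing in the absolute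
   value on this range. *)
have cosC x : `|x| <= Dinf -> C <= cos (x + alpha).
  move=> xD; rewrite -cos_norm.
  have xa : `|x + alpha| < Dinf + delta.
    by apply: le_lt_trans (ler_normD _ _) _; rewrite ler_ltD // gtr0_norm.
  have := normr_ge0 (x + alpha).
  move: (`|x + alpha|) xa; clear -Dinf0 alpha0 alpha_delta delta_pi => a a_lt a0.
  by rewrite ltW // ltr_cos // in_itv /=; apply/andP; split; lra.
have r0 : 0 < beta / gamma by rewrite divr_gt0.
have r1 : beta / gamma < 1 by rewrite ltr_pdivrMr // mul1r.
(* As [beta / gamma] is positive, [2 / (1 - beta / gamma)] exceeds 2. The same lower bound on [c],
   rearranged, gives [beta / gamma <= eta c]. *)
have c2 : 2 < c.
  apply: lt_trans hc_eta; rewrite ltr_pdivlMr ?subr_gt0 //; clear -r0; lra.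
have beta_eta : beta <= eta c * gamma.
  rewrite -ler_pdivrMr // /eta lerBrDr addrC -lerBrDr ler_pdivrMr // mulrC.
  by move: hc_eta; rewrite ltr_pdivrMr ?subr_gt0 // => /ltW.
have [eta0 eta1] := andP (eta_bounds c2).
have pl0 := psi_l_gt0 hN hconn; have pu0 := psi_u_gt0 hN hconn.
have S0 : 0 < geom_sum N c := lt_le_trans ltr01 (geom_sum_ge1 c2 hN).
have n0 : 0 < N%:R :> R by rewrite ltr0n.
move: hmK; rewrite lt_min => /andP[].
rewrite ltr_pdivlMr ?mulr_gt0 ?exprn_gt0 // => hmK1.
rewrite ltr_pdivlMr ?mulr_gt0 // => hmK2.
have ca1 : cos alpha <= 1 := cos_le1 _.
have r_le1 : sin gamma / gamma <= 1 by rewrite ler_pdivrMr // mul1r.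
(* The factor [eta c ^+ 2] in the bound on [m * K] is at most 1. *)
have mK : m * K * (16 * N%:R * psi_u psi ^+ 2 * geom_sum N c)
    <= psi_l psi * (sin gamma / gamma).
  rewrite [leRHS]mulrA ler_pdivlMr //.
  have -> : m * K * (16 * N%:R * psi_u psi ^+ 2 * geom_sum N c) * gamma =
    m * K * (16 * N%:R * psi_u psi ^+ 2 * geom_sum N c * gamma) by ring.
  apply: le_trans (ltW hmK1) _; by rewrite -mulrA ler_piMl ?expr_le1 // ltW // mulr_gt0.
pose lam := cos alpha * (sin gamma / gamma).
have ca01 : 0 < cos alpha <= 1 by rewrite ca0.
have mG := decay_rate_small_inertia c2 hN hconn hm hK ca01 mK.
have mG2 : 16 * m * (K * psi_u psi * 1) ^+ 2 <= decay_rate c psi K 1.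
  have one01 : 0 < (1 : R) <= 1 by rewrite ltr01 lexx.
  apply: le_trans (decay_rate_small_inertia c2 hN hconn hm hK one01 mK) _.
  by apply: (decay_rate_mono c2 hN hconn) => //; rewrite mul1r.
(* With [lam = 1] this is the second bound on [m * K]; the smaller [lam] of the phase estimate
   follows by monotonicity. *)
have mB2 : 2 * m * decay_rate c psi K 1 <= 1.
  rewrite /decay_rate mulr1 mulrA ler_pdivrMr // mul1r.
  have -> : 2 * m * (K / N%:R * psi_l psi) = m * K * (2 * psi_l psi) / N%:R by ring.
  by rewrite ler_pdivrMr // [leRHS]mulrC ltW.
have mB : 2 * m * decay_rate c psi K lam <= 1.
  apply: le_trans mB2; rewrite ler_pM2l ?mulr_gt0 //.
  apply: (decay_rate_mono c2 hN hconn) => //; apply: le_trans r_le1.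
  by rewrite ler_piMl // divr_ge0 // ltW.
have AB : 4 * (diam Omega + 2 * K * psi_u psi * sin alpha)
    < decay_rate c psi K lam * (Dinf * eta c).
  move: hK1; rewrite ltr_pdivrMr ?mulr_gt0 //.
  have -> : decay_rate c psi K lam * (Dinf * eta c) =
      K * (Dinf * eta c * psi_l psi * cos alpha * sin gamma)
      / (N%:R * geom_sum N c * gamma).
    by rewrite /decay_rate /lam; field; rewrite !gt_eqF.
  by rewrite ltr_pdivlMr ?mulr_gt0 // !mulrA.
have init : diam theta0 + 2 * m * diam omega0 < beta.
  have h1 : 0 <= 2 * m * diam Omega by rewrite mulr_ge0 ?diam_ge0 // ltW // mulr_gt0.
  have h2 : 0 <= 4 * m * K * psi_u psi * sin alpha by rewrite ltW // !mulr_gt0.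
  have h3 : 0 <= 4 * m * K * psi_u psi * cos alpha * diam theta0.
    by rewrite mulr_ge0 ?diam_ge0 // ltW // !mulr_gt0.
  have h4 : 0 <= m * diam omega0 by rewrite mulr_ge0 ?diam_ge0 // ltW.
  by clear -hinit h1 h2 h3 h4; lra.
have [T T0 locked] := phase_locking hm hK c2 hN hpsi hsym hconn sa0 ca0 gpi mG mB
  beta_eta Dinf0 Dinf_beta AB init.
(* [F] bounds the force diameter at time [T] through the phase bound [Dinf], and [Dinf / m] bounds
   the velocity diameter there. So [M], and with it the final constant, is fixed before any solution
   is introduced. *)
pose F := diam Omega + 2 * K * psi_u psi * sin alpha
  + 2 * (K * psi_u psi * cos alpha) * Dinf.
have F0 : 0 <= F.
  by apply: addr_ge0; [apply: addr_ge0; first exact: diam_ge0|]; rewrite ltW // !mulr_gt0.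
pose M := 2 * F + Dinf / m.
have M0 : 0 < M by rewrite ltr_wpDl ?mulr_ge0 ?divr_gt0.
pose B2 := decay_rate c psi K 1.
have B20 : 0 < B2 := decay_rate_gt0 c2 hN hconn hK ltr01.
pose kap := B2 / (2 * (K * psi_u psi * 1)).
have kap0 : 0 < kap by rewrite divr_gt0 // !mulr_gt0.
exists T, (((eta c)^-1 + kap^-1) * M), (B2 / 2); split; first exact: ltW.
- by rewrite mulr_gt0 // addr_gt0 // invr_gt0.
- by rewrite divr_gt0.
move=> theta omega sol init0 t Tt.
have th0 : theta 0 = theta0 by apply/funext => i; case: (init0 i).
have om0 : omega 0 = omega0 by apply/funext => i; case: (init0 i).
have thD s : T <= s -> diam (theta s) <= Dinf by case/(locked _ _ sol th0 om0).
have initM : 2 * diam (force K alpha Omega psi (theta T)) + diam (omega T) < M.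
  have [_ wT] := locked _ _ sol th0 om0 T (lexx T).
  have FT : diam (force K alpha Omega psi (theta T)) <= F.
    apply: le_trans (force_diam Omega hK hN hpsi hconn sa0 ca0 _) _.
    by rewrite lerD2l ler_pM2l ?thD // !mulr_gt0.
  apply: ler_ltD; first by rewrite ler_pM2l.
  by rewrite ltr_pdivlMr // mulrC; apply: le_lt_trans wT _; clear -Dinf0; lra.
have := velocity_energy_decay hm hK c2 hN hpsi hsym hconn sol T0 mG2 mB2
  cC (ltW C0) thD cosC M0 initM Tt.
by rewrite /exp_decay add0r [X in _ <= X -> _]mulrA.
Qed.
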